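(* Let $G$ be a graph with maximum degree $\Delta(G)=4$ (loops and multiple edges are allowed). Then $G$ has a strong edge-coloring using at most 22 colors.
   Context: A strong edge-coloring of a graph is an assignment of colors to its edges that is a proper edge-coloring (no two edges sharing an endpoint receive the same color) and, in addition, no two edges of the same color lie on a common path of length three (equivalently, two edges that share an endpoint or are joined by a third edge must receive different colors). Graphs are finite and may contain loops and multiple edges. *)

(* Defs.v *)
From mathcomp Require Import all_boot.
Set Implicit Arguments. Unset Strict Implicit. Unset Printing Implicit Defensive.

(* A finite multigraph (loops and parallel edges allowed): a finite vertex
   type V, a finite edge type E, and each edge e has the two endpoints
   [ends1 e] and [ends2 e] (equal for a loop).  The orientation is irrelevant:
   every notion below is symmetric in ends1/ends2. *)

(* Degree of v: number of edge-ends at v (a loop contributes 2). *)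
Definition deg (V E : finType) (ends1 ends2 : E -> V) (v : V) : nat :=
  \sum_(e : E) ((ends1 e == v) + (ends2 e == v)).

Definition incident (V E : finType) (ends1 ends2 : E -> V) (e : E) (v : V) : bool :=
  (ends1 e == v) || (ends2 e == v).

Definition share_end (V E : finType) (ends1 ends2 : E -> V) (e f : E) : bool :=
  [exists v, incident ends1 ends2 e v && incident ends1 ends2 f v].

Definition strong_edge_coloring (V E : finType) (ends1 ends2 : E -> V) (k : nat)
    (c : E -> 'I_k) : Prop :=
  forall e f : E, e != f ->
    (share_end ends1 ends2 e f \/
     exists g : E, share_end ends1 ends2 e g /\ share_end ends1 ends2 g f) ->
    c e != c f.

(* Main.v *)
Require Import Defs.
From mathcomp Require Import all_boot zify.
Set Implicit Arguments. Unset Strict Implicit. Unset Printing Implicit Defensive.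

(* Fix a vertex v and color the edges in order of decreasing distance from v.
   An edge e away from v has at most 24 conflicts, and four of them, the edges
   at a neighbor of an end of e that is closer to v, come later; so there is
   room for 22 colors even if some matching between the neighbors of v and the
   vertices at distance 2 was precolored.  It remains to color the (at most
   four) edges at v.  They all see the at most 12 edges [near v], and the edge
   from v to w also sees the at most 9 edges [beyond v w].  So it suffices to
   choose v and the precoloring such that enough colors are repeated on
   [near v], or enough edges in these sets coincide.  Fewer than four neighbors
   or a triangle at v save enough; otherwise the component is simple,
   4-regular and triangle-free.  If v lies on a 4-cycle, let z be a vertex with
   the most common neighbors with v; then no, one or two repeated pairs suffice.
   If there is no 4-cycle, three repetitions are obtained from an independent
   transversal of the four triples of second neighbors; it exists unless the
   component is a Moore graph of degree 4 and diameter 2, and there is none. *)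

(** * Cardinality bounds for finite sets *)

Lemma card_bigcup_le (I T : finType) (A : {set I}) (F : I -> {set T}) k :
  (forall i, i \in A -> #|F i| <= k) -> #|\bigcup_(i in A) F i| <= #|A| * k.
Proof.
move=> Fk; rewrite -sum_nat_const.
elim/big_rec2: _ => [|i n B iA IH]; first by rewrite cards0.
by apply: leq_trans (leq_card_setU _ _) _; rewrite leq_add // Fk.
Qed.

Lemma cardsU_le (T : finType) (A B : {set T}) a b :
  #|A| <= a -> #|B| <= b -> #|A :|: B| <= a + b.
Proof. by move=> Aa Bb; apply: leq_trans (leq_card_setU _ _) (leq_add Aa Bb). Qed.

Lemma cardsD1_le (T : finType) (A : {set T}) x k :
  x \in A -> #|A| <= k.+1 -> #|A :\ x| <= k.
Proof. by move=> xA; rewrite (cardsD1 x A) xA. Qed.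

Lemma cardsD_le (T : finType) (A B : {set T}) x k :
  x \in A -> x \in B -> #|A| <= k.+1 -> #|A :\: B| <= k.
Proof.
move=> xA xB Ak; apply: leq_trans (cardsD1_le xA Ak).
by rewrite subset_leq_card // setDS // sub1set.
Qed.

Lemma avoid_colors k (A : {set 'I_k}) : #|A| < k -> exists a, a \notin A.
Proof.
move=> Ak; have : 0 < #|~: A| by rewrite -(ltn_add2l #|A|) cardsC addn0 card_ord.
by case/card_gt0P=> a; rewrite inE => aA; exists a.
Qed.

(** * Incidence, adjacency and conflicts *)

Section Multigraph.
Variables (V E : finType) (ends1 ends2 : E -> V).

Definition edges_at x : {set E} := [set e | incident ends1 ends2 e x].
(** Meant for [e] at [x]: a loop returns [x] itself, and an edge not at [x] gets the default
    [ends1 e]. *)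
Definition other x e := if ends1 e == x then ends2 e else ends1 e.
Definition nbrs x : {set V} := [set other x e | e in edges_at x].
Definition adj x y := y \in nbrs x.
Definition conflict e f := (e != f) &&
  [exists a, exists b, [&& e \in edges_at a, f \in edges_at b & (a == b) || adj a b]].

Local Notation Es := edges_at.

Lemma other_edge x e : e \in Es x -> e \in Es (other x e).
Proof.
rewrite /other !inE /incident; case: eqP => [<-|_] /=; by rewrite eqxx ?orbT.
Qed.

Lemma edge_ends x y e : e \in Es x -> e \in Es y -> (y == x) || (y == other x e).
Proof.
rewrite /other !inE /incident (eq_sym y) (eq_sym y).
by case: (ends1 e =P x) => [->|_] //=; move=> /eqP-> ; rewrite orbC.
Qed.

Lemma otherK x e : e \in Es x -> other (other x e) e = x.
Proof.
rewrite /other !inE /incident; case: (ends1 e =P x) => [->|n1] /=.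
  by case: eqP.
by rewrite eqxx => /eqP.
Qed.

Lemma adjP x y : reflect (exists2 e, e \in Es x & other x e = y) (adj x y).
Proof. by apply: (iffP imsetP) => -[e ex ey]; exists e. Qed.

Lemma adj_sym : symmetric adj.
Proof.
move=> x y; apply/adjP/adjP => -[e ex <-]; exists e;
  by rewrite ?other_edge // ?otherK.
Qed.

Lemma share_endP e f :
  reflect (exists x, e \in Es x /\ f \in Es x) (share_end ends1 ends2 e f).
Proof.
apply: (iffP existsP) => -[x]; first by case/andP=> ? ?; exists x; rewrite !inE.
by rewrite !inE => -[? ?]; exists x; apply/andP.
Qed.

Lemma conflict_strong e f : e != f ->
  share_end ends1 ends2 e f \/
    (exists g, share_end ends1 ends2 e g /\ share_end ends1 ends2 g f) ->
  conflict e f.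
Proof.
move=> nef H; rewrite /conflict nef /=.
case: H => [/share_endP[x [ex fx]]|[g [/share_endP[x [ex gx]] /share_endP[y [gy fy]]]]].
  by apply/existsP; exists x; apply/existsP; exists x; rewrite ex fx eqxx.
apply/existsP; exists x; apply/existsP; exists y; rewrite ex fy eq_sym /=.
by have /orP[->|/eqP->] := edge_ends gx gy; rewrite ?/adj ?imset_f ?orbT.
Qed.

Lemma conflict_sym : symmetric conflict.
Proof.
move=> e f; rewrite /conflict eq_sym; congr (_ && _).
by apply/existsP/existsP=> -[a /existsP[b /and3P[ea fb ab]]];
  exists b; apply/existsP; exists a; rewrite ea fb eq_sym adj_sym.
Qed.

Definition reach x (A : {set E}) :=
  A :|: \bigcup_(h in A) (Es (other x h) :\ h).

(** A conflict comes from equal or adjacent ends [a], [b]. If the edge joining them is not [e], then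
    [f] is reached through it; if it is [e], then [f] sits at the other end of [e]. *)
Lemma conflict_reach e f x : e \in Es x -> conflict e f ->
  f \in reach x (Es x :\ e) :|: reach (other x e) (Es (other x e) :\ e).
Proof.
move=> ex /andP[nef /existsP[a /existsP[b /and3P[ea fb ab]]]].
have key z : e \in Es z -> (z == b) || adj z b ->
    (f \in reach z (Es z :\ e)) || ((b == other z e) && (f \in Es (other z e) :\ e)).
  move=> ez; case/orP => [/eqP zb|/adjP[h hz hb]].
    by rewrite 3!inE eq_sym nef zb fb.
  case: (h =P e) => [he|/eqP nhe].
    by rewrite -he hb eqxx in_setD1 fb he (eq_sym f) nef orbT.
  have hA : h \in Es z :\ e by rewrite 2!inE nhe.
  rewrite in_setU; apply/orP; left; case: (f =P h) => [->|/eqP nfh]; first by rewrite hA.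
  by apply/orP; right; apply/bigcupP; exists h; rewrite // 2!inE nfh hb.
have sub z y : f \in Es z :\ e -> f \in y :|: reach z (Es z :\ e).
  by move=> H; rewrite !in_setU H orbT.
have /orP[/eqP az|/eqP az] := edge_ends ex ea.
  rewrite az in ea ab; have /orP[H|/andP[_ /sub->//]] := key _ ea ab.
  by rewrite in_setU H.
rewrite az in ea ab; have /orP[H|/andP[_]] := key _ ea ab.
  by rewrite in_setU H orbT.
by rewrite otherK // setUC; apply: sub.
Qed.

(** * Partial colorings and their extension by one edge *)

Definition valid (D : {set E}) (c : E -> 'I_22) :=
  forall e f, e \in D -> f \in D -> conflict e f -> c e != c f.

(** [X] collects the forbidden colors; 21 of them leave one of the 22 free. Colorings are total
    functions, but their values off [D] carry no meaning. *)
Lemma valid_extend (D : {set E}) c e (X : {set 'I_22}) : valid D c ->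
  (forall f, f \in D -> conflict e f -> c f \in X) -> #|X| <= 21 -> e \notin D ->
  exists2 c', valid (e |: D) c' & {in D, c' =1 c}.
Proof.
move=> vD cX X21 eD; have [a aX] := avoid_colors (X21 : #|X| < 22).
pose c' f := if f == e then a else c f.
have c'D : {in D, c' =1 c}.
  by move=> f fD; rewrite /c'; case: eqP => // fe; rewrite -fe fD in eD.
exists c' => // f g; rewrite !inE.
have new h : h \in D -> conflict e h -> a != c' h.
  by move=> hD eh; rewrite c'D //; apply: contraNneq aX => ->; apply: cX.
have c'e : c' e = a by rewrite /c' eqxx.
case: (f =P e) => [->|_] /=; case: (g =P e) => [->|_] /=.
- by rewrite /conflict eqxx.
- by move=> _ gD /(new _ gD); rewrite c'e.
- by move=> fD _; rewrite conflict_sym c'e eq_sym; apply: new.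
by move=> fD gD; rewrite !c'D //; apply: vD.
Qed.

Hypothesis deg4 : forall x, deg ends1 ends2 x <= 4.

Lemma edges_at_le x : #|Es x| <= 4.
Proof.
apply: leq_trans (deg4 x); rewrite /deg -sum1_card [leqLHS]big_mkcond leq_sum // => e _.
by rewrite inE /incident; case: (_ == _); case: (_ == _).
Qed.

(** A loop uses up two of the four edge-ends at [x]. *)
Lemma loop_edges_at x e : e \in Es x -> other x e = x -> #|Es x| <= 3.
Proof.
move=> ex ox; rewrite -ltnS; apply: leq_trans (deg4 x).
rewrite /deg (bigD1 e) //= (cardsD1 e) ex -addSn leq_add //.
  move: ex ox; rewrite inE /incident /other.
  by case: eqP => [_ _ ->|n1 _ /n1 //]; rewrite eqxx.
rewrite -sum1_card [leqLHS]big_mkcond [leqRHS]big_mkcond leq_sum // => f _.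
by rewrite !inE /incident; do 3 case: (_ == _).
Qed.

Lemma nbrs_le x : #|nbrs x| <= 4.
Proof. exact: leq_trans (leq_imset_card _ _) (edges_at_le x). Qed.

Lemma reach_le x (A : {set E}) : A \subset Es x -> #|reach x A| <= #|A| * 4.
Proof.
move=> /subsetP sA; rewrite (_ : #|A| * 4 = #|A| + #|A| * 3); last lia.
apply: cardsU_le => //; apply: card_bigcup_le => h /sA hx.
by apply: cardsD1_le (edges_at_le _); apply: other_edge.
Qed.


(** * Conflicts of an edge at the center, and greedy coloring *)

Definition near v : {set E} := \bigcup_(y in nbrs v) (Es y :\: Es v).
Definition beyond v w : {set E} :=
  \bigcup_(x in nbrs w :\ v) (Es x :\: (near v :|: Es v)).

Lemma near_notin v e : e \in Es v -> e \notin near v.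
Proof. by move=> ev; apply/bigcupP=> -[y _]; rewrite in_setD ev. Qed.

Lemma conflict_center v e f : e \in Es v -> f \notin Es v -> conflict e f ->
  f \in near v :|: beyond v (other v e).
Proof.
move=> ev fv /(conflict_reach ev).
have inM y : y \in nbrs v -> f \in Es y -> f \in near v :|: beyond v (other v e).
  by move=> yv fy; rewrite in_setU; apply/orP; left; apply/bigcupP; exists y;
    rewrite // in_setD fv.
have inM' h : h \in Es v -> f \in Es (other v h) -> f \in near v :|: beyond v (other v e).
  by move=> hv; apply: inM; apply: imset_f.
rewrite in_setU /reach !in_setU => /orP[] /orP[].
- by rewrite in_setD1 (negPf fv) andbF.
- by case/bigcupP=> h; rewrite !in_setD1 => /andP[_ hv] /andP[_]; rewrite -in_setU; apply: inM'.
- by rewrite in_setD1 => /andP[_]; rewrite -in_setU; apply: inM'.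
case/bigcupP=> h; rewrite !in_setD1 => /andP[_ hw] /andP[_ fx]; rewrite -in_setU.
have [hv|hv] := boolP (h \in Es v).
  have /orP[/eqP vw|/eqP vo] := edge_ends hw hv; last by rewrite vo fx in fv.
  by rewrite -vw in hw fx; apply: inM' fx.
rewrite in_setU; have [//|fM] := boolP (f \in near v); apply/bigcupP.
exists (other (other v e) h); last by rewrite in_setD in_setU (negPf fM) (negPf fv).
rewrite in_setD1 imset_f // andbT; apply: contraNneq hv => <-.
exact: other_edge.
Qed.

(* [b e] bounds the number of colors that [e] sees on edges away from the
   center; [i] edges at the center are colored before the sequence [s]. *)
Fixpoint fits (b : E -> nat) i s :=
  if s is e :: s' then (b e + i <= 21) && fits b i.+1 s' else true.

Lemma color_center v m s D c i : {subset s <= Es v} -> valid D c ->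
  #|c @: (D :&: near v)| <= m -> #|D :&: Es v| <= i ->
  fits (fun e => m + #|beyond v (other v e)|) i s ->
  exists c', valid (D :|: [set e in s]) c'.
Proof.
elim: s D c i => [|e s IH] D c i sv vD cm Di.
  by move=> _; exists c; move=> f g; rewrite !in_setU !inE !orbF; apply: vD.
have ev : e \in Es v by apply: sv; rewrite inE eqxx.
have sv' : {subset s <= Es v} by move=> f fs; apply: sv; rewrite inE fs orbT.
case/andP=> be fs; have -> : D :|: [set f in e :: s] = (e |: D) :|: [set f in s].
  by apply/setP=> f; rewrite !inE; case: (f \in D); case: (f == e).
(* If [e] is already colored nothing changes, and the count [i] may be raised harmlessly. *)
have [eD|eD] := boolP (e \in D).
  rewrite (_ : e |: D = D); last by apply/setUidPr; rewrite sub1set.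
  exact: IH sv' vD cm (leqW Di) fs.
have [||c' vc' cc'] := @valid_extend D c e
  (c @: (D :&: near v) :|: c @: beyond v (other v e) :|: c @: (D :&: Es v)) vD _ _ eD.
- move=> f fD ef; rewrite in_setU; have [fv|fv] := boolP (f \in Es v).
    by rewrite [_ \in c @: (D :&: Es v)]imset_f ?orbT // in_setI fD.
  have := conflict_center ev fv ef; rewrite !in_setU => /orP[fM|fB].
    by rewrite imset_f // in_setI fD.
  by rewrite [_ \in c @: beyond _ _]imset_f ?orbT.
- apply: leq_trans be; apply: cardsU_le; last exact: leq_trans (leq_imset_card _ _) Di.
  by apply: cardsU_le => //; apply: leq_imset_card.
apply: IH vc' _ _ fs => //.
  rewrite (_ : (e |: D) :&: near v = D :&: near v).
    rewrite (eq_in_imset (g := c)) // => f; rewrite in_setI => /andP[fD _]; exact: cc'.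
  apply/setP=> f; rewrite !in_setI in_setU1; case: eqP => [->|//].
  by rewrite (negPf (near_notin ev)) !andbF.
rewrite setIUl; apply: leq_trans (leq_card_setU _ _) _.
rewrite -add1n leq_add //; apply: leq_trans (subset_leq_card (subsetIl _ _)) _.
by rewrite cards1.
Qed.

(** Greedy coloring: the bound counts conflicts in all of [D] and [s], so it covers every stage. *)
Lemma valid_extend_seq (s : seq E) (D : {set E}) c : valid D c ->
  (forall e, e \in s ->
     #|[set f in D :|: [set e in s] | conflict e f]| <= 21) ->
  exists2 c', valid (D :|: [set e in s]) c' & {in D, c' =1 c}.
Proof.
elim: s D c => [|e s IH] D c vD bnd.
  by exists c => //; move=> f g; rewrite !in_setU !inE !orbF; apply: vD.
have -> : D :|: [set f in e :: s] = (e |: D) :|: [set f in s].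
  by apply/setP=> f; rewrite !inE; case: (f \in D); case: (f == e).
have bnd' f : f \in s -> #|[set g in e |: D :|: [set e in s] | conflict f g]| <= 21.
  move=> fs; apply: leq_trans (bnd f _); last by rewrite inE fs orbT.
  apply: subset_leq_card; apply/subsetP=> g; rewrite !inE.
  by case: (g == e); rewrite ?orbT.
have [eD|eD] := boolP (e \in D).
  have De : e |: D = D by apply/setUidPr; rewrite sub1set.
  by rewrite De in bnd' *; apply: IH.
have [||c1 v1 cc1] := @valid_extend D c e (c @: [set f in D | conflict e f]) vD _ _ eD.
- by move=> f fD ef; rewrite imset_f // inE fD.
- apply: leq_trans (leq_imset_card _ _) _.
  apply: leq_trans (bnd e _); last by rewrite inE eqxx.
  by apply: subset_leq_card; apply/subsetP=> g; rewrite !inE => /andP[-> ->].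
have [c2 v2 cc2] := IH _ _ v1 bnd'.
by exists c2 => // f fD; rewrite cc2 ?cc1 // inE fD orbT.
Qed.

Definition outside v (T : {set V}) : {set E} :=
  [set e | [&& connect adj v (ends1 e), ends1 e \notin T & ends2 e \notin T]].

Lemma outside_notin v T e x : e \in outside v T -> e \in Es x -> x \notin T.
Proof. by rewrite !inE /incident => /and3P[_ ? ?] /orP[] /eqP <-. Qed.

(* If [u] outside [T] has a neighbor [u'] in [T], the edges at [u] that miss
   [T] are added last: all edges at [u'] conflict with them, and at most one of
   those is colored, which leaves at most 21 colored conflicts. *)
Lemma color_outside v (D0 : {set E}) p : valid D0 p ->
  (forall x, #|Es x :&: D0| <= 1) ->
  forall T : {set V}, v \in T ->
  exists2 c, valid (D0 :|: outside v T) c & {in D0, c =1 p}.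
Proof.
move=> v0 D01 T; have [n] := ubnP #|~: T|; elim: n T => // n IH T Tn vT.
have [/existsP[u' /existsP[u /and3P[u'T uT u'u]]]|noexit] :=
    boolP [exists u', exists u, [&& u' \in T, u \notin T & adj u' u]]; last first.
  have clT : closed adj (mem T).
    have H x y : adj x y -> x \in T -> y \in T.
      move=> xy xT; apply: contraR noexit => yT.
      by apply/existsP; exists x; apply/existsP; exists y; rewrite xT yT.
    by move=> x y xy; apply/idP/idP; apply: H; rewrite // adj_sym.
  exists p => //; rewrite (_ : outside v T = set0) ?setU0 //; apply/setP=> e.
  rewrite !inE; apply/and3P=> -[/(closed_connect clT) eT /negP[]].
  by rewrite -[_ \in T]eT.
have [||c vc cp] := IH (u |: T); rewrite ?inE ?vT ?orbT //.
  apply: leq_trans (_ : #|~: T| <= n) => //.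
  by apply: proper_card; rewrite properC properUr // sub1set.
pose s := enum (outside v T :\: outside v (u |: T)).
have [|c' vc' cc'] := @valid_extend_seq s _ _ vc; last first.
  exists c'; last by move=> f fD; rewrite cc' ?cp // inE fD.
  rewrite (_ : D0 :|: outside v T = D0 :|: outside v (u |: T) :|: [set e in s]) //.
  apply/setP=> f; rewrite !inE mem_enum !inE; case: (f \in D0) => //=.
  case: connect => //=; case: (_ == u); case: (_ == u); case: (_ \in T); case: (_ \in T) => //.
move=> e; rewrite mem_enum in_setD => /andP[eT' eT].
have eu : e \in Es u.
  move: eT eT'; rewrite !inE /incident => /and3P[-> /negPf-> /negPf->] /=.
  by rewrite !orbF; case: (ends1 e == u) => //=; case: (ends2 e == u).
have /adjP[g gu gu'] : adj u u' by rewrite adj_sym.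
have gT : g \in Es u' by rewrite -gu' other_edge.
have eg : g != e by apply: contraTneq gT => ->; apply: contraL u'T; apply: outside_notin eT.
set R1 := reach u (Es u :\ e :\ g).
set R2 := reach (other u e) (Es (other u e) :\ e).
apply: leq_trans (_ : #|R1 :|: R2 :|: (Es u' :&: D0)| <= 21).
  apply: subset_leq_card; apply/subsetP=> f; rewrite inE => /andP[fD ef].
  have fu' : f \in Es u' -> f \in R1 :|: R2 :|: (Es u' :&: D0).
    move=> fu'; rewrite in_setU in_setI fu'; apply/orP; right.
    move: fD; rewrite !in_setU => /orP[]; first case/orP=> [//|fT].
      by have /negP[] := outside_notin fT fu'; rewrite inE u'T orbT.
    rewrite inE mem_enum in_setD => /andP[_ fT].
    by have /negP[] := outside_notin fT fu'.
  have /setUP[/setUP[fu|/bigcupP[h hu fh]]|fR] := conflict_reach eu ef.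
  - case: (f =P g) => [fg|/eqP fg]; first by apply: fu'; rewrite fg.
    by do 3 (apply/setUP; left); rewrite in_setD1 fg fu.
  - case: (h =P g) => [hg|/eqP hg].
      by apply: fu'; move: fh; rewrite hg gu' in_setD1 => /andP[].
    do 2 (apply/setUP; left); apply/setUP; right.
    by apply/bigcupP; exists h; rewrite // in_setD1 hg.
  by apply/setUP; left; apply/setUP; right.
(* Besides [e] and [g], at most two edges at [u] reach 8 edges; three at the other end of [e] reach
   12. A colored edge at [u'] must lie in [D0], which gives the final 1. *)
apply: (@cardsU_le _ _ _ 20 1) => //; apply: (@cardsU_le _ _ _ 8 12).
  have sA : Es u :\ e :\ g \subset Es u.
    by apply: subset_trans (subsetDl _ _) (subsetDl _ _).
  apply: leq_trans (reach_le sA) _; rewrite (leq_mul2r 4 _ 2) /=.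
  by do 2 (apply: cardsD1_le; rewrite ?in_setD1 ?eg //); apply: edges_at_le.
apply: leq_trans (reach_le (subsetDl _ _)) _; rewrite (leq_mul2r 4 _ 3) /=.
by apply: cardsD1_le (edges_at_le _); apply: other_edge.
Qed.

(** [D0] is the precolored matching. Its edges show only the colors in [p @: D0], and every other
    edge of [near v] is allotted a color of its own. The order of coloring at [v] is [s]. *)
Definition good v := exists (D0 : {set E}) (p : E -> 'I_22),
  [/\ D0 \subset near v, valid D0 p, forall x, #|Es x :&: D0| <= 1 &
   exists2 s, s =i Es v &
     fits (fun e => #|near v| - #|D0| + #|p @: D0| + #|beyond v (other v e)|) 0 s].

Lemma good_color v : good v ->
  exists c, valid [set e | connect adj v (ends1 e)] c.
Proof.
case=> D0 [p [D0M v0 D01 [s sv fs]]].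
(* With [T] equal to [[set v]], everything in the component except the edges at [v] gets colored. *)
have [c vc cp] := color_outside v0 D01 (set11 v).
have [|||c' vc'] := @color_center v _ s _ _ 0 _ vc _ _ fs.
- by move=> e; rewrite sv.
- set D := _ :|: _; have sub : c @: (D :&: near v) \subset c @: (near v :\: D0) :|: c @: D0.
    rewrite -imsetU imsetS //; apply/subsetP=> e; rewrite !inE => /andP[_ ->].
    by case: (e \in D0).
  apply: leq_trans (subset_leq_card sub) _; apply: cardsU_le.
    by apply: leq_trans (leq_imset_card _ _) _; rewrite cardsDS.
  by rewrite (eq_in_imset cp).
- rewrite leqn0 cards_eq0; apply/eqP/setP=> e; rewrite !in_setI in_set0.
  apply/negP=> /andP[+ ev]; rewrite in_setU => /orP[/(subsetP D0M)|/outside_notin].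
    by apply/negP/near_notin.
  by move/(_ _ ev); rewrite set11.
exists c' => e f; rewrite [e \in _]inE [f \in _]inE => ve vf.
have inD g : connect adj v (ends1 g) -> g \in D0 :|: outside v [set v] :|: [set e in s].
  by rewrite !inE sv inE /incident => ->; case: (_ == v); case: (_ == v); rewrite ?orbT.
by apply: vc'; apply: inD.
Qed.

(** * Criteria for a good center *)

Lemma fits_le b k i s : (forall e, e \in s -> b e <= k) -> k + i + size s <= 22 ->
  fits b i s.
Proof.
elim: s i => //= e s IH i bk ks; have be := bk e (mem_head _ _).
apply/andP; split; first lia.
by apply: IH => [f fs|]; [apply: bk; rewrite inE fs orbT | lia].
Qed.

Lemma fits_cat b i s1 s2 : fits b i (s1 ++ s2) = fits b i s1 && fits b (i + size s1) s2.
Proof. by elim: s1 i => [|e s IH] i /=; rewrite ?addn0 // IH addSnnS andbA. Qed.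

Lemma sub_fits b b' i s : (forall e, b e <= b' e) -> fits b' i s -> fits b i s.
Proof.
move=> bb'; elim: s i => //= e s IH i /andP[be /IH->]; rewrite andbT.
by apply: leq_trans be; rewrite leq_add2r.
Qed.

Lemma fits_flat b v : (forall e, e \in Es v -> b e <= 18) ->
  exists2 s, s =i Es v & fits b 0 s.
Proof.
move=> b18; exists (enum (Es v)); first by move=> e; rewrite mem_enum.
apply: (@fits_le _ 18) => [e|]; first by rewrite mem_enum; apply: b18.
by rewrite -cardE (leq_add2l 18 _ 4) edges_at_le.
Qed.

(** The at most two other edges come first and see at most 20 + 1 colors; then [e1] sees 19 + 2 and
    [e2] sees 18 + 3. *)
Lemma fits_last2 b v e1 e2 : e1 \in Es v -> e2 \in Es v -> e1 != e2 ->
  (forall e, e \in Es v -> b e <= 20) -> b e1 <= 19 -> b e2 <= 18 ->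
  exists2 s, s =i Es v & fits b 0 s.
Proof.
move=> e1v e2v e12 b20 b19 b18; pose A := Es v :\ e1 :\ e2.
have A2 : size (enum A) <= 2.
  rewrite -cardE; apply: cardsD1_le; first by rewrite in_setD1 eq_sym e12.
  by apply: cardsD1_le (edges_at_le v).
exists (enum A ++ [:: e1; e2]).
  move=> e; rewrite mem_cat mem_enum !in_setD1 !in_cons in_nil.
  by case: eqP => [->|_]; case: eqP => [->|_]; rewrite ?orbT ?orbF ?e1v ?e2v.
rewrite fits_cat; apply/andP; split.
  apply: (@fits_le _ 20) => [e|]; last by rewrite addn0 (leq_add2l 20 _ 2).
  by rewrite mem_enum !in_setD1 => /and3P[_ _]; apply: b20.
by rewrite /=; lia.
Qed.

(** * Sizes of the near and beyond sets *)

Lemma near_term v y : y \in nbrs v -> #|Es y :\: Es v| <= 3.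
Proof.
case/adjP=> e ev <-.
exact: cardsD_le (other_edge ev) ev (edges_at_le _).
Qed.

Lemma near_le v : #|near v| <= #|nbrs v| * 3.
Proof. by apply: card_bigcup_le => y; apply: near_term. Qed.

Lemma near_le12 v : #|near v| <= 12.
Proof. by apply: leq_trans (near_le v) _; rewrite (leq_mul2r 3 _ 4) nbrs_le. Qed.

Local Notation deg_in v x := #|nbrs x :&: nbrs v|.

Lemma edges_at_near v y : y \in nbrs v -> Es y \subset near v :|: Es v.
Proof.
move=> yv; apply/subsetP=> e ey; rewrite in_setU orbC; case: (boolP (e \in Es v)) => //= ev.
by apply/bigcupP; exists y; rewrite // in_setD ev.
Qed.

(** Each common neighbor of [x] and [v] yields a different edge at [x] that is near [v] or at [v],
    hence is removed here. *)
Lemma beyond_term v x : #|Es x :\: (near v :|: Es v)| <= 4 - deg_in v x.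
Proof.
have H : deg_in v x <= #|Es x :&: (near v :|: Es v)|.
  apply: leq_trans (leq_imset_card (other x) _); apply: subset_leq_card.
  apply/subsetP=> y /setIP[/adjP[e ex <-] yv]; apply: imset_f; rewrite in_setI ex.
  by apply: (subsetP (edges_at_near yv)); apply: other_edge.
have := cardsID (near v :|: Es v) (Es x); have := edges_at_le x; lia.
Qed.

Lemma beyond_term_nbrs v x : x \in nbrs v -> #|Es x :\: (near v :|: Es v)| = 0.
Proof. by move=> /edges_at_near; rewrite -setD_eq0 => /eqP->; rewrite cards0. Qed.

Lemma beyond_term3 v w x : w \in nbrs v -> x \in nbrs w ->
  #|Es x :\: (near v :|: Es v)| <= 3.
Proof.
move=> wv /adjP[e ew <-]; apply: cardsD_le (other_edge ew) _ (edges_at_le _).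
exact: (subsetP (edges_at_near wv)).
Qed.

Lemma nbrsD1_le v w : w \in nbrs v -> #|nbrs w :\ v| <= 3.
Proof. by move=> wv; apply: cardsD1_le (nbrs_le w); rewrite -/(adj w v) adj_sym. Qed.

Lemma beyond_le9 v w : w \in nbrs v -> #|beyond v w| <= 9.
Proof.
move=> wv; apply: leq_trans (card_bigcup_le (k := 3) _) _; last first.
  by rewrite (leq_mul2r 3 _ 3) nbrsD1_le.
by move=> x /setD1P[_]; apply: beyond_term3.
Qed.

(** The other two second neighbors through [w] contribute at most three edges each. *)
Lemma beyond_drop v w x t : w \in nbrs v -> x \in nbrs w :\ v ->
  #|Es x :\: (near v :|: Es v)| <= t -> #|beyond v w| <= t + 6.
Proof.
move=> wv xw xt; rewrite /beyond (big_setD1 x) //=; apply: cardsU_le => //.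
apply: leq_trans (card_bigcup_le (k := 3) _) _; last first.
  by rewrite (leq_mul2r 3 _ 2); apply: cardsD1_le xw (nbrsD1_le wv).
by move=> y /setD1P[_ /setD1P[_]]; apply: beyond_term3.
Qed.

Lemma beyond_drop2 v w x y t u : w \in nbrs v ->
  x \in nbrs w :\ v -> y \in nbrs w :\ v -> x != y ->
  #|Es x :\: (near v :|: Es v)| <= t -> #|Es y :\: (near v :|: Es v)| <= u ->
  #|beyond v w| <= t + (u + 3).
Proof.
move=> wv xw yw xy xt yu; rewrite /beyond (big_setD1 x) //=; apply: cardsU_le => //.
have yA : y \in nbrs w :\ v :\ x by rewrite in_setD1 eq_sym xy.
rewrite (big_setD1 y) //=; apply: cardsU_le => //.
apply: leq_trans (card_bigcup_le (k := 3) _) _; last first.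
  by rewrite (leq_mul2r 3 _ 1); apply: cardsD1_le yA _; apply: cardsD1_le xw (nbrsD1_le wv).
by move=> z /setD1P[_ /setD1P[_ /setD1P[_]]]; apply: beyond_term3.
Qed.

(** * Loops, parallel edges, triangles, and the general precoloring criterion *)

Lemma good_uncolored v : 
  (exists2 s, s =i Es v & fits (fun e => #|near v| + #|beyond v (other v e)|) 0 s) ->
  good v.
Proof.
case=> s sv fs; exists set0, (fun=> ord0); split; rewrite ?sub0set //.
- by move=> e f; rewrite inE.
- by move=> x; rewrite setI0 cards0.
exists s => //; apply: sub_fits fs => e.
by rewrite imset0 !cards0 subn0 addn0.
Qed.

Lemma good_few_nbrs v : #|nbrs v| <= 3 -> good v.
Proof.
move=> v3; apply: good_uncolored; apply: fits_flat => e ev.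
apply: (@leq_add _ _ 9 9); last by apply/beyond_le9/imset_f.
by apply: leq_trans (near_le v) _; rewrite (leq_mul2r 3 _ 3).
Qed.

(** Three neighbors give 9 + 9 = 18 seen colors, which [fits_flat] accepts; a loop at [v] leaves at
    most three edges, hence at most three neighbors. *)
Lemma bad_simple v : ~ good v -> #|nbrs v| = 4 /\ ~~ adj v v.
Proof.
move=> bv; have v4 : #|nbrs v| = 4.
  have := nbrs_le v; have /negP : ~ (#|nbrs v| <= 3) by move/good_few_nbrs.
  by rewrite -ltnNge => *; apply/eqP; rewrite eqn_leq; apply/andP.
split=> //; apply/adjP=> -[e ev /(loop_edges_at ev)] v3.
by have := leq_imset_card (other v) (Es v); rewrite [#|_ @: _|]v4 leqNgt ltnS v3.
Qed.

(** An edge [h] between [w1] and [w2] is counted from both of them, so [near v] has at most 11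
    edges. Moreover [w2] contributes nothing to [beyond v w1], and conversely, so both sets drop to
    6; the edges to [w1] and [w2] go last. *)
Lemma bad_triangle_free v w1 w2 : ~ good v -> w1 \in nbrs v -> w2 \in nbrs v ->
  w1 != w2 -> ~~ adj w1 w2.
Proof.
move=> bv; have [v4 vv] := bad_simple bv.
move=> w1v w2v w12; apply/negP=> a12; apply: bv; apply: good_uncolored.
have nv w : w \in nbrs v -> w != v by move=> wv; apply: contraNneq vv => wE; rewrite wE in wv.
have n11 : #|near v| <= 11.
  have /adjP[h h1 h2] := a12.
  have hv : h \notin Es v.
    apply/negP=> hv; have := edge_ends h1 hv.
    by rewrite h2 eq_sym (negPf (nv _ w1v)) eq_sym (negPf (nv _ w2v)).
  have h2' : h \in Es w2 by rewrite -h2 other_edge.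
  rewrite /near (big_setD1 w1) //= setUC.
  rewrite (_ : _ :|: _ = \bigcup_(y in nbrs v :\ w1) (Es y :\: Es v) :|: (Es w1 :\: Es v) :\ h).
    apply: (@cardsU_le _ _ _ 9 2).
      apply: leq_trans (card_bigcup_le (k := 3) _) _; last first.
        by rewrite (leq_mul2r 3 _ 3); apply: cardsD1_le w1v (nbrs_le v).
      by move=> y /setD1P[_]; apply: near_term.
    by apply: cardsD1_le; rewrite ?in_setD ?hv //; apply: near_term.
  apply/setP=> e; rewrite !in_setU in_setD1.
  case: (e =P h) => [->|//] /=; rewrite orbF; symmetry.
  suff -> : h \in \bigcup_(y in nbrs v :\ w1) (Es y :\: Es v) by [].
  by apply/bigcupP; exists w2; rewrite ?in_setD1 ?w2v ?in_setD ?hv // eq_sym w12.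
have [/adjP[e1 e1v o1] /adjP[e2 e2v o2]] : adj v w1 /\ adj v w2 by [].
have b6 w w' : w \in nbrs v -> w' \in nbrs v -> adj w w' -> #|beyond v w| <= 6.
  move=> wv w'v ww'; apply: (@beyond_drop v w w' 0) => //.
    by rewrite in_setD1 nv.
  by rewrite beyond_term_nbrs.
apply: (@fits_last2 _ _ e1 e2) => //.
- by apply: contraNneq w12 => e12; rewrite -o1 -o2 e12.
- by move=> e ev; apply: (@leq_add _ _ 11 9) => //; apply/beyond_le9/imset_f.
- by rewrite o1; apply: leq_trans (leq_add n11 (b6 _ _ w1v w2v a12)) _.
by rewrite o2; apply: leq_trans (leq_add n11 (b6 _ _ w2v w1v _)) _; rewrite // adj_sym.
Qed.

(** The matching consists of one edge from each [w] in [W] to [g w], colored [k w]. As neighbors of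
    [v] are pairwise nonadjacent, conflicts between two such edges can only come from the pairs that
    the hypotheses control. *)
Lemma good_precolored v (W : {set V}) w0 (g : V -> V) (k : V -> 'I_22) :
  ~~ adj v v -> {in nbrs v &, forall w w', ~~ adj w w'} ->
  w0 \in W -> W \subset nbrs v ->
  (forall w, w \in W -> g w \in nbrs w :\ v) ->
  (forall w w', w \in W -> w' \in W -> w != w' -> g w != g w' /\
     (k w = k w' -> ~~ adj (g w) (g w') /\ ~~ adj w (g w'))) ->
  (exists2 s, s =i Es v &
     fits (fun e => 12 - #|W| + #|k @: W| + #|beyond v (other v e)|) 0 s) ->
  good v.
Proof.
move=> vv tf w0W /subsetP sW gW cW [s sv fs].
(* A value is required at every vertex; off [W], an edge at [w0] serves as default. *)
have /fin_all_exists[eW HeW] w : exists e, w \in W -> e \in Es w /\ other w e = g w.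
  have [wW|wW] := boolP (w \in W).
    by have /setD1P[_ /adjP[e ew eg]] := gW _ wW; exists e.
  by have /setD1P[_ /adjP[e _ _]] := gW _ w0W; exists e.
have adjg w : w \in W -> adj w (g w) by case/gW/setD1P.
have ends x w : w \in W -> eW w \in Es x -> x = w \/ x = g w.
  move=> wW ex; have [ew ow] := HeW _ wW.
  by have /orP[/eqP|/eqP] := edge_ends ew ex; rewrite ?ow; [left|right].
have ntf w w' : w \in W -> w' \in W -> w <> g w'.
  move=> wW w'W e; have := adjg _ w'W; apply/negP; rewrite -e.
  by apply: tf; apply: sW.
have sep x w w' : w \in W -> w' \in W -> eW w \in Es x -> eW w' \in Es x -> w = w'.
  move=> wW w'W ex ex'; apply/eqP/negPn/negP=> nw; have [/eqP ng _] := cW _ _ wW w'W nw.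
  have [xw|xw] := ends _ _ wW ex; have [xw'|xw'] := ends _ _ w'W ex'.
  - by move/eqP: nw; apply; rewrite -xw -xw'.
  - by apply: (ntf w w'); rewrite // -xw -xw'.
  - by apply: (ntf w' w); rewrite // -xw -xw'.
  - by apply: ng; rewrite -xw -xw'.
have injE : {in W &, injective eW}.
  move=> w w' wW w'W ee; have [ew _] := HeW _ wW.
  by apply: (sep w) => //; rewrite -ee.
(* An edge is decoded back to its [w]; the default [v] only matters for edges outside the
   matching. *)
pose p f := k (odflt v [pick w in W | eW w == f]).
have pE w : w \in W -> p (eW w) = k w.
  move=> wW; rewrite /p; case: pickP => [w' /andP[w'W /eqP/injE->]|/(_ w)] //.
  by rewrite /= wW eqxx.
exists (eW @: W), p; split.
- apply/subsetP=> _ /imsetP[w wW ->]; apply/bigcupP; exists w; first exact: sW.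
  have [ew _] := HeW _ wW; rewrite in_setD ew andbT; apply/negP=> ev.
  have [e|e] := ends _ _ wW ev; first by move/negP: vv; apply; rewrite {2}e; apply: sW.
  by have := gW _ wW; rewrite -e setD11.
- move=> _ _ /imsetP[w wW ->] /imsetP[w' w'W ->]; rewrite !pE //.
  case/andP=> nee /existsP[a /existsP[b /and3P[ea eb ab]]].
  have nw : w != w' by apply: contraNneq nee => ->.
  apply/eqP=> kk; have [/eqP ng /(_ kk) [n1 n2]] := cW _ _ wW w'W nw.
  have w'w : w' != w by rewrite eq_sym.
  have [_ /(_ (esym kk)) [_ n3]] := cW _ _ w'W wW w'w.
  have [aw|aw] := ends _ _ wW ea; have [bw|bw] := ends _ _ w'W eb; rewrite aw bw in ab;
    case/orP: ab => [/eqP ab|ab].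
  + by rewrite ab eqxx in nw.
  + by move: (tf _ _ (sW _ wW) (sW _ w'W)); rewrite ab.
  + exact: ntf ab.
  + by rewrite ab in n2.
  + exact: ntf (esym ab).
  + by rewrite adj_sym ab in n3.
  + exact: ng.
  + by rewrite ab in n1.
- move=> x; apply/card_le1_eqP=> f1 f2 /setIP[ex /imsetP[w wW we]] /setIP[ex' /imsetP[w' w'W we']].
  by rewrite we in ex; rewrite we' in ex'; rewrite we we' (sep _ _ _ wW w'W ex ex').
exists s => //; apply: sub_fits fs => e; rewrite leq_add2r.
have pI : p @: (eW @: W) = k @: W.
  apply/setP=> a; apply/imsetP/imsetP => [[_ /imsetP[w wW ->] ->]|[w wW ->]].
    by exists w; rewrite // pE.
  by exists (eW w); rewrite ?imset_f // pE.
by rewrite pI card_in_imset // leq_add2r leq_sub2r // near_le12.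
Qed.

(** * Components without a good center *)

Section Component.
Variable C : {set V}.
Hypothesis C_adj : forall x y, x \in C -> adj x y -> y \in C.
Hypothesis C_bad : forall x, x \in C -> ~ good x.

Local Notation second v w := (nbrs w :\ v).

Lemma comp_nbrs x : x \in C -> #|nbrs x| = 4.
Proof. by move=> /C_bad/bad_simple[]. Qed.

Lemma comp_irr x : x \in C -> ~~ adj x x.
Proof. by move=> /C_bad/bad_simple[]. Qed.

Lemma comp_triangle x y z : x \in C -> adj x y -> adj x z -> adj y z -> False.
Proof.
move=> xC xy xz; case: (eqVneq y z) => [<-|nyz]; apply/negP.
  by apply: comp_irr; apply: C_adj xy.
exact: (bad_triangle_free (C_bad xC)).
Qed.

Lemma nbrs_independent v : v \in C -> {in nbrs v &, forall w w', ~~ adj w w'}.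
Proof. by move=> vC w w' vw vw'; apply/negP; apply: (comp_triangle vC vw). Qed.

Lemma enum_nbrs v w1 w2 : v \in C -> w1 \in nbrs v -> w2 \in nbrs v -> w1 != w2 ->
  exists w3 w4, nbrs v =i [:: w1; w2; w3; w4] /\ uniq [:: w1; w2; w3; w4].
Proof.
move=> vC w1v w2v w12; have := comp_nbrs vC; rewrite (cardsD1 w1) w1v.
rewrite (cardsD1 w2) in_setD1 eq_sym w12 w2v => -[/eqP/cards2P[w3 [w4 [w34 e]]]].
exists w3, w4; have H x : (x \in nbrs v :\ w1 :\ w2) = (x == w3) || (x == w4).
  by rewrite e !inE.
have := H w3; rewrite eqxx !in_setD1 => /and3P[n32 n31 _].
have := H w4; rewrite eqxx orbT !in_setD1 => /and3P[n42 n41 _].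
split; last first.
  rewrite /= !inE !negb_or w12 w34 (eq_sym w1 w3) (eq_sym w1 w4) (eq_sym w2 w3).
  by rewrite (eq_sym w2 w4) n31 n32 n41 n42.
move=> x; have := H x; rewrite !inE.
by case: eqP => [->|_]; case: eqP => [->|_]; rewrite ?w1v ?w2v ?orbT.
Qed.

Lemma second_C v w x : v \in C -> w \in nbrs v -> x \in second v w -> x \in C.
Proof. by move=> vC vw /setD1P[_ wx]; apply: C_adj wx; apply: C_adj vw. Qed.

Lemma second_notin v w x : v \in C -> w \in nbrs v -> x \in second v w -> x \notin nbrs v.
Proof. by move=> vC vw /setD1P[_ wx]; apply/negP => /(comp_triangle vC vw); apply. Qed.

Lemma card_second v w : v \in C -> w \in nbrs v -> #|second v w| = 3.
Proof.
move=> vC vw; have wC := C_adj vC vw.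
have := comp_nbrs wC; rewrite (cardsD1 v) (_ : v \in nbrs w) => [[]//|].
by rewrite -/(adj w v) adj_sym.
Qed.

(** Each chosen second neighbor sees [nbrs v] only in its own [nth v ws i], so the four are distinct
    and only adjacency among them can obstruct equal colors. The 8 is 12 minus the four precolored
    edges. *)
Lemma good_transversal v (ws ys : seq V) (col : nat -> 'I_22) :
  v \in C -> nbrs v =i ws -> uniq ws -> size ws = 4 ->
  (forall i, i < 4 -> nth v ys i \in second v (nth v ws i)) ->
  (forall i, i < 4 -> nbrs (nth v ys i) :&: nbrs v = [set nth v ws i]) ->
  (forall i j, i < j -> j < 4 -> col i = col j -> ~~ adj (nth v ys i) (nth v ys j)) ->
  (exists2 s, s =i Es v & fits
     (fun e => 8 + #|[set col (i : 'I_4) | i in 'I_4]| + #|beyond v (other v e)|) 0 s) ->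
  good v.
Proof.
move=> vC vws uws s4 ysP prv ncol [s sv fs].
have iws w : w \in nbrs v -> index w ws < 4 by rewrite vws -index_mem s4.
have nws w : w \in nbrs v -> nth v ws (index w ws) = w by rewrite vws; apply: nth_index.
have v4 := comp_nbrs vC.
have [w0 w0v] : exists w, w \in nbrs v by apply/card_gt0P; rewrite v4.
pose g w := nth v ys (index w ws).
have gP w : w \in nbrs v -> nbrs (g w) :&: nbrs v = [set w].
  by move=> wv; rewrite /g prv ?iws // nws.
apply: (@good_precolored _ (nbrs v) w0 g (fun w => col (index w ws))) => //.
- exact: comp_irr.
- exact: nbrs_independent.
- by move=> w wv; rewrite -{2}(nws w wv); apply: ysP; apply: iws.
- move=> w w' wv w'v nw; split.
    apply: contraNneq nw => e; have := gP _ wv; rewrite e (gP _ w'v).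
    by move/setP/(_ w'); rewrite !inE eqxx eq_sym => <-.
  move=> cw; split.
    have : index w ws != index w' ws.
      by apply: contraNneq nw => e; rewrite -(nws _ wv) e nws.
    by rewrite neq_ltn => /orP[] ij; last rewrite adj_sym; apply: ncol; rewrite ?iws.
  apply: contra nw => aw; have := gP _ w'v => /setP/(_ w).
  by rewrite in_setI wv -/(adj _ _) adj_sym aw inE.
exists s => //; apply: sub_fits fs => e; rewrite leq_add2r v4 leq_add2l.
apply: subset_leq_card; apply/subsetP=> _ /imsetP[w wv ->].
by apply/imsetP; exists (Ordinal (iws w wv)).
Qed.

(** * Centers on a 4-cycle *)

(** All edges at [z] are near [v], so every [beyond] set has at most 6 edges, and 12 + 6 = 18. *)
Lemma good_common4 v z : v \in C -> z != v -> #|nbrs z :&: nbrs v| = 4 -> good v.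
Proof.
move=> vC zv z4; apply: good_uncolored; apply: fits_flat => e ev.
apply: (@leq_add _ _ 12 6); first exact: near_le12.
have wv : other v e \in nbrs v by apply: imset_f.
have zw : adj z (other v e).
  have /eqP : nbrs z :&: nbrs v = nbrs v.
    by apply/eqP; rewrite eqEcard subsetIr z4 comp_nbrs.
  by move/eqP/setP/(_ (other v e)); rewrite in_setI wv andbT.
apply: (@beyond_drop v _ z 0) => //; first by rewrite in_setD1 zv -/(adj _ z) adj_sym.
by have := beyond_term v z; rewrite z4.
Qed.

(** One repeated color suffices: edges [i]-[z] and [j]-[y] are colored alike, leaving 11 colors on
    [near v]. The edges to [w'] and [w] go last, with 11 + 8 and 11 + 7. *)
Lemma good_common23 v z w : v \in C -> z != v ->
  1 < #|nbrs z :&: nbrs v| < 4 ->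
  (forall x, x != v -> #|nbrs x :&: nbrs v| <= #|nbrs z :&: nbrs v|) ->
  w \in nbrs v -> #|beyond v w| <= 7 -> good v.
Proof.
move=> vC zv /andP[z2 z4] zmax wv b7.
have [w' /setD1P[nw' /setIP[zw' w'v]]] : exists w', w' \in (nbrs z :&: nbrs v) :\ w.
  by apply/card_gt0P; move: z2; rewrite (cardsD1 w); case: (_ \in _) => /=; lia.
have zC : z \in C by apply: (C_adj (C_adj vC w'v)); rewrite adj_sym.
have b8 : #|beyond v w'| <= 8.
  apply: (@beyond_drop v w' z 2) => //; first by rewrite in_setD1 zv -/(adj _ z) adj_sym.
  by apply: leq_trans (beyond_term v z) _; lia.
have [j jv jz] : exists2 j, j \in nbrs v & j \notin nbrs z.
  apply/subsetPn; apply/negP=> /setIidPr e; move: z4.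
  by rewrite e comp_nbrs.
(* Otherwise [z] would be adjacent to three second neighbors and at least two neighbors of [v], five
   in all. *)
have [y yj yz] : exists2 y, y \in second v j & y \notin nbrs z.
  apply/subsetPn/negP=> sub.
  have : #|second v j :|: (nbrs z :&: nbrs v)| <= 4.
    by rewrite -(comp_nbrs zC) subset_leq_card // subUset sub subsetIl.
  rewrite cardsU (_ : second v j :&: _ = set0) ?cards0 ?card_second //; first by lia.
  apply/setP=> x; rewrite in_set0; apply/negP=> /setIP[xj /setIP[_ xv]].
  by have := second_notin vC jv xj; rewrite xv.
have yv : y != v by case/setD1P: yj.
(* Otherwise [y], also adjacent to [j], would have more common neighbors with [v] than [z], against
   maximality. *)
have [i /setIP[zi iv] iy] : exists2 i, i \in nbrs z :&: nbrs v & i \notin nbrs y.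
  apply/subsetPn/negP=> sub; have := zmax _ yv; apply/negP; rewrite -ltnNge.
  apply: leq_trans (_ : #|j |: (nbrs z :&: nbrs v)| <= _).
    by rewrite cardsU1 in_setI (negPf jz).
  apply: subset_leq_card; rewrite subUset sub1set !in_setI jv subsetI sub subsetIr.
  by rewrite !andbT -/(adj y j) adj_sym; case/setD1P: yj.
have ij : j != i by apply: contraNneq jz => ->.
have zy : z != y by apply: contraNneq iy => <-.
pose g x := if x == i then z else y.
have gi : g i = z by rewrite /g eqxx.
have gj : g j = y by rewrite /g (negPf ij).
have [e1 e1v o1] := adjP _ _ (w'v : adj v w').
have [e2 e2v o2] := adjP _ _ (wv : adj v w).
have c1 : 12 - #|[set i; j]| + #|(fun=> ord0 : 'I_22) @: [set i; j]| <= 11.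
  rewrite cards2 eq_sym ij (leq_add2l 10 _ 1); apply: leq_trans (_ : #|[set ord0 : 'I_22]| <= 1).
    by apply: subset_leq_card; apply/subsetP=> _ /imsetP[? _ ->]; rewrite inE.
  by rewrite cards1.
apply: (@good_precolored v [set i; j] i g (fun=> ord0)).
- exact: comp_irr.
- exact: nbrs_independent.
- by rewrite !inE eqxx.
- by rewrite subUset !sub1set iv jv.
- move=> x; rewrite !inE => /orP[]/eqP->; rewrite ?gi ?gj //.
    by rewrite zv -/(adj _ z) adj_sym.
  by move: yj; rewrite !inE.
- have nzy : ~~ adj z y by [].
  have niy : ~~ adj i y by rewrite adj_sym.
  have njz : ~~ adj j z by rewrite adj_sym.
  move=> x x'; rewrite !inE => /orP[]/eqP-> /orP[]/eqP->; rewrite ?eqxx // => _;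
    by rewrite gi gj // eq_sym (adj_sym y z).
apply: (@fits_last2 _ v e1 e2) => //.
- by apply: contraNneq nw' => e; rewrite -o1 -o2 e.
- by move=> e ev; apply: (leq_add c1 (_ : _ <= 9)); apply/beyond_le9/imset_f.
- by rewrite o1; apply: (leq_add c1 b8).
by rewrite o2; apply: (leq_add c1 b7).
Qed.

Definition private v w := [set x in second v w | nbrs x :&: nbrs v == [set w]].

(** Two non-private second neighbors would contribute at most 2 edges each and the third at most 3,
    which makes 7. *)
Lemma card_private v w : v \in C -> w \in nbrs v -> 7 < #|beyond v w| ->
  1 < #|private v w|.
Proof.
move=> vC wv b7; rewrite ltnNge; apply: contraL b7 => p1; rewrite -leqNgt.
have sp : private v w \subset second v w by apply/subsetP=> x; rewrite inE => /andP[].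
have : 1 < #|second v w :\: private v w| by rewrite cardsDS // card_second //; lia.
case/card_gt1P=> x [y [/setDP[xw xp] /setDP[yw yp] xy]].
have t2 u : u \in second v w -> u \notin private v w ->
    #|Es u :\: (near v :|: Es v)| <= 2.
  move=> uw; rewrite inE uw /= => up; apply: leq_trans (beyond_term v u) _.
  suff : 1 < #|nbrs u :&: nbrs v| by lia.
  rewrite ltnNge; apply: contra up => u1; rewrite eq_sym eqEcard cards1 u1 andbT.
  by rewrite sub1set in_setI wv andbT -/(adj u w) adj_sym; case/setD1P: uw.
by apply: (@beyond_drop2 v w x y 2 2) => //; apply: t2.
Qed.

(** Otherwise [a] would have five neighbors: [w] and at least two private vertices at each of [w']
    and [w'']. *)
Lemma private_avoid v w w' w'' a : v \in C ->
  w \in nbrs v -> w' \in nbrs v -> w'' \in nbrs v -> w' != w'' ->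
  1 < #|private v w'| -> 1 < #|private v w''| -> a \in second v w ->
  (forall c, c \in private v w' -> adj a c) ->
  exists2 d, d \in private v w'' & ~~ adj a d.
Proof.
move=> vC wv w'v w''v nw p' p'' aw full.
apply/subsetPn/negP=> sub; have aC := second_C vC wv aw.
have dis : private v w' :&: private v w'' = set0.
  apply/setP=> x; rewrite in_set0; apply/negP=> /setIP[].
  rewrite !inE => /andP[_ /eqP ->] /andP[_ /eqP/setP/(_ w')].
  by rewrite !inE eqxx (negPf nw).
have : #|w |: (private v w' :|: private v w'')| <= 4.
  rewrite -(comp_nbrs aC); apply: subset_leq_card.
  rewrite !subUset sub1set sub andbT -/(adj a w) adj_sym.
  by case/setD1P: aw => _ wa; rewrite /adj wa; apply/subsetP=> c /full.
rewrite cardsU1 cardsU dis cards0 (_ : w \notin _) /=; first by lia.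
apply/negP=> /setUP[]; rewrite inE => /andP[/second_notin H _].
  by have := H vC w'v; rewrite wv.
by have := H vC w''v; rewrite wv.
Qed.

(** Two colors on a transversal of private vertices leave 8 + 2 = 10 on [near v]; the edge to [w0]
    goes last, with 10 + 8. *)
Lemma good_two_pairs v w0 : v \in C -> (forall w, w \in nbrs v -> 1 < #|private v w|) ->
  w0 \in nbrs v -> #|beyond v w0| <= 8 -> good v.
Proof.
move=> vC pr w0v b8.
have [w1 /setD1P[w10 w1v]] : exists w, w \in nbrs v :\ w0.
  by apply/card_gt0P; have := comp_nbrs vC; rewrite (cardsD1 w0) w0v add1n => -[->].
have two_colors a b c d ws : nbrs v =i ws -> uniq ws -> size ws = 4 ->
    a \in private v (nth v ws 0) -> b \in private v (nth v ws 1) ->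
    c \in private v (nth v ws 2) -> d \in private v (nth v ws 3) ->
    ~~ adj a c -> ~~ adj b d -> good v.
  rewrite !inE => vws uws s4 /andP[aw /eqP ap] /andP[bw /eqP bp] /andP[cw /eqP cp] /andP[dw /eqP dp] ac bd.
  (* Coloring by parity makes positions 0 and 2 agree, and likewise 1 and 3. *)
  apply: (@good_transversal v ws [:: a; b; c; d] (fun i => inord (odd i))) => //.
  - by case=> [|[|[|[|i]]]] // _; rewrite in_setD1.
  - by case=> [|[|[|[|i]]]].
  - have ne : (inord true : 'I_22) != inord false.
      by apply/eqP => /(congr1 val); rewrite /= !inordK.
    by case=> [|[|[|[|i]]]] [|[|[|[|j]]]] //= _ _ e; rewrite e eqxx in ne.
  have c2 : #|[set (inord (odd i) : 'I_22) | i : 'I_4]| <= 2.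
    apply: leq_trans (_ : #|[set inord true; (inord false : 'I_22)]| <= 2).
      apply: subset_leq_card; apply/subsetP=> _ /imsetP[i _ ->].
      by case: (odd i); rewrite !inE eqxx ?orbT.
    by rewrite cards2 ltnS leq_b1.
  have [e1 e1v o1] := adjP _ _ (w1v : adj v w1).
  have [e2 e2v o2] := adjP _ _ (w0v : adj v w0).
  apply: (@fits_last2 _ v e1 e2) => // [|e ev||]; rewrite ?o1 ?o2.
  - by apply: contraNneq w10 => e; rewrite -o1 -o2 e.
  - apply: leq_trans (_ : 8 + 2 + 9 <= _) => //.
    by rewrite leq_add // ?leq_add2l // beyond_le9 // imset_f.
  - by apply: (@leq_add _ _ 10 9); rewrite ?beyond_le9 // (leq_add2l 8 _ 2).
  by apply: (@leq_add _ _ 10 8); rewrite ?(leq_add2l 8 _ 2).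
have w01 : w0 != w1 by rewrite eq_sym.
have [w2 [w3 [vws uws]]] := enum_nbrs vC w0v w1v w01.
have [w2v w3v] : w2 \in nbrs v /\ w3 \in nbrs v by rewrite !vws !inE !eqxx !orbT.
move: (uws); rewrite /= !inE !negb_or => /and4P[/and3P[_ w02 w03] /andP[w12 w13] w23 _].
have w32 : w3 != w2 by rewrite eq_sym.
have w21 : w2 != w1 by rewrite eq_sym.
have w20 : w2 != w0 by rewrite eq_sym.
have w31 : w3 != w1 by rewrite eq_sym.
pose N w w' := exists a c, [/\ a \in private v w, c \in private v w' & ~~ adj a c].
have Nsym w w' : N w w' -> N w' w by case=> a [c [? ? ?]]; exists c, a; rewrite adj_sym.
(* If the private sets of [w] and [w'] are completely joined, [private_avoid] provides nonadjacent
   pairs for both [w], [x] and [w'], [x']. *)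
have Nalt w w' x x' : w \in nbrs v -> w' \in nbrs v -> x \in nbrs v -> x' \in nbrs v ->
    w' != x -> w != x' -> N w w' \/ N w x /\ N w' x'.
  move=> wv w'v xv x'v nx nx'.
  have [/existsP[a /existsP[c /and3P[aw cw ac]]]|none] :=
      boolP [exists a, exists c, [&& a \in private v w, c \in private v w' & ~~ adj a c]].
    by left; exists a, c.
  have full a c : a \in private v w -> c \in private v w' -> adj a c.
    move=> aw cw; apply: contraR none => ac.
    by apply/existsP; exists a; apply/existsP; exists c; rewrite aw cw.
  have [/(card_gt1P) [a [_ [aw _ _]]] /card_gt1P[c [_ [cw _ _]]]] := (pr _ wv, pr _ w'v).
  right; split.
    have [||d dx ad] := private_avoid vC wv w'v xv nx (pr _ w'v) (pr _ xv) (a := a).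
    - by move: aw; rewrite inE => /andP[].
    - by move=> c' /(full _ _ aw).
    by exists a, d.
  have [||d dx ad] := private_avoid vC w'v wv x'v nx' (pr _ wv) (pr _ x'v) (a := c).
  - by move: cw; rewrite inE => /andP[].
  - by move=> a' a'w; rewrite adj_sym; apply: full.
  by exists c, d.
(* A failure of either pair in one pairing of the four neighbors produces the whole other
   pairing. *)
have [[N02 N13]|[N03 N12]] : (N w0 w2 /\ N w1 w3) \/ (N w0 w3 /\ N w1 w2).
  have [N02|[N03 /Nsym N12]] := Nalt w0 w2 w3 w1 w0v w2v w3v w1v w23 w01; last by right.
  have [N13|[N12 /Nsym N03]] := Nalt w1 w3 w2 w0 w1v w3v w2v w0v w32 w10; last by right.
  by left.
- have [[a [c [aw cw ac]]] [b [d [bw dw bd]]]] := (N02, N13).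
  exact: (two_colors a b c d _ vws uws).
have [[a [c [aw cw ac]]] [b [d [bw dw bd]]]] := (N03, N12).
apply: (two_colors a b c d [:: w0; w1; w3; w2]) => //.
  by move=> x; rewrite vws !inE; case: (x == w2); case: (x == w3); rewrite ?orbT.
move: uws; rewrite /= !inE !negb_or => /and4P[/and3P[-> -> ->] /andP[-> ->] _ _].
by rewrite w32.
Qed.

(** * Components without 4-cycles *)

Hypothesis C_square : forall x y, x \in C -> x != y -> #|nbrs x :&: nbrs y| <= 1.

Lemma square_free x y a b : x \in C -> adj x a -> adj x b -> adj y a -> adj y b ->
  x = y \/ a = b.
Proof.
move=> xC xa xb ya yb; case: (eqVneq x y) => [->|xy]; first by left.
by right; have /card_le1_eqP := C_square xC xy; apply; rewrite in_setI; apply/andP.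
Qed.

Section Root.
Variable v : V.
Hypothesis vC : v \in C.

Lemma second_common w x : w \in nbrs v -> x \in second v w -> nbrs x :&: nbrs v = [set w].
Proof.
move=> wv xw; have [xv wx] := setD1P xw.
apply/eqP; rewrite eq_sym eqEcard cards1 C_square ?(second_C vC wv xw) // andbT.
by rewrite sub1set in_setI wv andbT -/(adj x w) adj_sym.
Qed.

Lemma second_unique w w' x y y' : w \in nbrs v -> w' \in nbrs v ->
  x \in second v w -> y \in second v w' -> y' \in second v w' ->
  adj x y -> adj x y' -> y = y'.
Proof.
move=> wv w'v xw /setD1P[_ yw] /setD1P[_ yw'] xy xy'.
have [xw'|//] := square_free (second_C vC wv xw) xy xy' yw yw'.
by have := second_notin vC wv xw; rewrite xw' w'v.
Qed.

(** Each of [x] and [y] has at most one neighbor in the triple at [w], so one of its three vertices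
    is free. *)
Lemma second_avoid w1 w2 w x y : w1 \in nbrs v -> w2 \in nbrs v -> w \in nbrs v ->
  x \in second v w1 -> y \in second v w2 ->
  exists z, [/\ z \in second v w, ~~ adj x z & ~~ adj y z].
Proof.
move=> w1v w2v wv xw yw.
have le1 u wu : wu \in nbrs v -> u \in second v wu -> #|second v w :&: nbrs u| <= 1.
  move=> wuv uw; apply/card_le1_eqP => a b /setIP[aw ua] /setIP[bw ub].
  exact: esym (second_unique wuv wv uw aw bw ua ub).
have /subsetPn[z zw zn] : ~~ (second v w \subset (second v w :&: nbrs x) :|: (second v w :&: nbrs y)).
  apply/negP=> /subset_leq_card; rewrite card_second // leqNgt ltnS.
  by rewrite (@cardsU_le _ _ _ 1 1) // ?(le1 x w1) ?(le1 y w2).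
exists z; move: zn; rewrite !in_setU !in_setI zw negb_or => /andP[].
by split.
Qed.

(** An independent transversal is chosen greedily, ending at [w2]: [x] meets nothing there, so [y]
    has only [z] and [t] to avoid. One color on it gives 8 + 1 + 9 = 18. *)
Lemma good_missing w1 w2 x : w1 \in nbrs v -> w2 \in nbrs v -> w1 != w2 ->
  x \in second v w1 -> (forall y, y \in second v w2 -> ~~ adj x y) -> good v.
Proof.
move=> w1v w2v w12 xw miss.
have [w3 [w4 [vws uws]]] := enum_nbrs vC w1v w2v w12.
have [w3v w4v] : w3 \in nbrs v /\ w4 \in nbrs v by rewrite !vws !inE !eqxx !orbT.
have [t [tw xt _]] := second_avoid w1v w1v w4v xw xw.
have [z [zw xz tz]] := second_avoid w1v w4v w3v xw tw.
have [y [yw zy ty]] := second_avoid w3v w4v w2v zw tw.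
apply: (@good_transversal v _ [:: x; y; z; t] (fun=> ord0) vC vws uws) => //.
- by case=> [|[|[|[|i]]]].
- by case=> [|[|[|[|i]]]] //= _; apply: second_common.
- case=> [|[|[|[|i]]]] [|[|[|[|j]]]] //= _ _ _; do ?[exact: miss | by rewrite adj_sym | by []].
apply: fits_flat => e ev; apply: (@leq_add _ _ 9 9); last by apply/beyond_le9/imset_f.
rewrite (leq_add2l 8 _ 1); apply: leq_trans (_ : #|[set ord0 : 'I_22]| <= 1).
  by apply: subset_leq_card; apply/subsetP=> _ /imsetP[? _ ->]; rewrite inE.
by rewrite cards1.
Qed.

Lemma second_cover w x y z u : w \in nbrs v ->
  x \in second v w -> y \in second v w -> z \in second v w ->
  x <> y -> x <> z -> y <> z -> u \in second v w -> [\/ u = x, u = y | u = z].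
Proof.
move=> wv xw yw zw /eqP xy /eqP xz /eqP yz uw.
have /setP/(_ u) : x |: [set y; z] = second v w.
  apply/eqP; rewrite eqEcard !subUset !sub1set xw yw zw /= card_second //.
  by rewrite cardsU1 cards2 yz !inE (negPf xy) (negPf xz).
by rewrite uw !inE => /or3P[]/eqP->; [constructor 1|constructor 2|constructor 3].
Qed.

(* Otherwise the graph would be a Moore graph of degree 4 and diameter 2. *)
Lemma good_square_free : good v.
Proof.
have [w1 w1v] : exists w, w \in nbrs v by apply/card_gt0P; rewrite comp_nbrs.
have [w2 /setD1P[w21 w2v]] : exists w, w \in nbrs v :\ w1.
  by apply/card_gt0P; have := comp_nbrs vC; rewrite (cardsD1 w1) w1v add1n => -[->].
have w12 : w1 != w2 by rewrite eq_sym.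
have [w3 [w4 [vws uws]]] := enum_nbrs vC w1v w2v w12.
have [w3v w4v] : w3 \in nbrs v /\ w4 \in nbrs v by rewrite !vws !inE !eqxx !orbT.
move: (uws); rewrite /= !inE !negb_or => /and4P[/and3P[_ w13 w14] /andP[w23 w24] w34 _].
have [w31 w41 w32 w42 w43] : [/\ w3 != w1, w4 != w1, w3 != w2, w4 != w2 & w4 != w3].
  by split; rewrite eq_sym.
have [/existsP[w /existsP[w' /existsP[x /and5P[wv w'v nw xw /forallP miss]]]]|hit] :=
  boolP [exists w, exists w', exists x, [&& w \in nbrs v, w' \in nbrs v, w != w',
    x \in second v w & [forall y, (y \in second v w') ==> ~~ adj x y]]].
  apply: (good_missing wv w'v nw xw) => y yw.
  by have := miss y; rewrite yw.
(* From here on, every second neighbor has a neighbor in each of the other three triples. *)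
have meet w w' x : w \in nbrs v -> w' \in nbrs v -> w != w' -> x \in second v w ->
    exists2 y, y \in second v w' & adj x y.
  move=> wv w'v nw xw; apply/exists_inP; apply: contraR hit => none.
  apply/existsP; exists w; apply/existsP; exists w'; apply/existsP; exists x.
  rewrite wv w'v nw xw /=; apply/forallP=> y; apply/implyP=> yw.
  by apply: contraNN none => xy; apply/exists_inP; exists y.
exfalso.
have inC w x : w \in nbrs v -> x \in second v w -> x \in C by apply: second_C.
have apart w w' x : w \in nbrs v -> w' \in nbrs v -> w != w' ->
    x \in second v w -> x \in second v w' -> False.
  move=> wv w'v nw xw xw'; have := second_common w'v xw'.
  by rewrite (second_common wv xw) => /setP/(_ w); rewrite !inE eqxx (negPf nw).
have sq w w' w'' w''' a b p q : w \in nbrs v -> w' \in nbrs v -> w'' \in nbrs v ->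
    w''' \in nbrs v -> w != w' -> w'' != w''' ->
    a \in second v w -> b \in second v w' -> p \in second v w'' -> q \in second v w''' ->
    adj a p -> adj a q -> adj b p -> adj b q -> False.
  move=> wv w'v w''v w'''v nw nw' aw bw pw qw ap aq bp bq.
  have [e|e] := square_free (inC _ _ wv aw) ap aq bp bq.
    by apply: (apart _ _ a wv w'v nw aw); rewrite e.
  by apply: (apart _ _ p w''v w'''v nw' pw); rewrite e.
have tri w a b c : w \in nbrs v -> a \in second v w -> adj a b -> adj a c -> adj b c -> False.
  by move=> wv aw; apply: comp_triangle; apply: inC aw.
have un w w' a b c : w \in nbrs v -> w' \in nbrs v ->
    a \in second v w -> b \in second v w' -> c \in second v w' -> adj a b -> adj a c -> b = c.
  by move=> wv w'v; apply: second_unique.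
(* The letters [x], [y], [z], [t] stand for the triples at [w1], [w2], [w3], [w4]; vertices with
   equal primes are adjacent to the [x] with those primes. The primes are fixed by letting [y] meet
   [z'] and [t'']. *)
have [x x1] : exists x, x \in second v w1 by apply/card_gt0P; rewrite card_second.
have [y y2 xy] := meet _ _ _ w1v w2v w12 x1.
have [z z3 xz] := meet _ _ _ w1v w3v w13 x1.
have [t t4 xt] := meet _ _ _ w1v w4v w14 x1.
have [z' z'3 yz'] := meet _ _ _ w2v w3v w23 y2.
have [t'' t''4 yt''] := meet _ _ _ w2v w4v w24 y2.
have [x' x'1 z'x'] := meet _ _ _ w3v w1v w31 z'3.
have [x'' x''1 t''x''] := meet _ _ _ w4v w1v w41 t''4.
have [y' y'2 x'y'] := meet _ _ _ w1v w2v w12 x'1.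
have [t' t'4 x't'] := meet _ _ _ w1v w4v w14 x'1.
have [y'' y''2 x''y''] := meet _ _ _ w1v w2v w12 x''1.
have [z'' z''3 x''z''] := meet _ _ _ w1v w3v w13 x''1.
have sym a b : adj a b -> adj b a by rewrite adj_sym.
have zz' : z <> z' by move=> e; rewrite -e in yz'; apply: tri x1 xy xz yz'.
have tt'' : t <> t'' by move=> e; rewrite -e in yt''; apply: tri x1 xy xt yt''.
have x'x : x' <> x.
  by move=> e; rewrite e in z'x'; apply: zz'; apply: (un w1 w3 x) => //; apply: sym.
have x''x : x'' <> x.
  by move=> e; rewrite e in t''x''; apply: tt''; apply: (un w1 w4 x) => //; apply: sym.
(* Equality would close the 4-cycle [y], [z'], [x'], [t'']. *)
have x'x'' : x' <> x''.
  move=> e; rewrite -e in t''x''.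
  exact: (sq _ _ _ _ y x' z' t'' w2v w1v w3v w4v w21 w34 _ _ _ _ yz' yt'' (sym _ _ z'x') (sym _ _ t''x'')).
have dist w w' a a' b b' : w \in nbrs v -> w' \in nbrs v ->
    a \in second v w -> a' \in second v w -> b \in second v w' ->
    a <> a' -> adj a b -> adj a' b' -> b <> b'.
  move=> wv w'v aw a'w bw na ab a'b' e; apply: na; apply: (un w' w b) => //; first exact: sym.
  by apply: sym; rewrite e.
have X2 := second_cover w2v y2 y'2 y''2.
have X3 := second_cover w3v z3 z'3 z''3.
have X4 := second_cover w4v t4 t'4 t''4.
have yy' : y <> y' by apply: (dist w1 w2 x x') => //; apply: nesym.
have yy'' : y <> y'' by apply: (dist w1 w2 x x'') => //; apply: nesym.
have y'y'' : y' <> y'' by apply: (dist w1 w2 x' x'').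
have zz'' : z <> z'' by apply: (dist w1 w3 x x'') => //; apply: nesym.
have z'z'' : z' <> z'' by apply: (dist w1 w3 x' x'') => //; apply: sym.
have tt' : t <> t' by apply: (dist w1 w4 x x') => //; apply: nesym.
have t't'' : t' <> t'' by apply: (dist w1 w4 x' x'') => //; apply: sym.
(* Here and in the next three claims one candidate closes a triangle with [x] and another a 4-cycle,
   so the third is the neighbor. *)
have tz'' : adj t z''.
  have [u u3 tu] := meet _ _ _ w4v w3v w43 t4.
  case: (X3 _ zz' zz'' z'z'' u3) => e; rewrite e in tu => //.
    by case: (tri _ _ _ _ w1v x1 xt xz tu).
  by case: (sq _ _ _ _ x z' y t w1v w3v w2v w4v w13 w24 _ _ _ _ xy xt (sym _ _ yz') (sym _ _ tu)).
have ty' : adj t y'.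
  have [u u2 tu] := meet _ _ _ w4v w2v w42 t4.
  case: (X2 _ yy' yy'' y'y'' u2) => e; rewrite e in tu => //.
    by case: (tri _ _ _ _ w1v x1 xt xy tu).
  by case: (sq _ _ _ _ x'' t y'' z'' w1v w4v w2v w3v w14 w23 _ _ _ _ x''y'' x''z'' tu tz'').
have zt' : adj z t'.
  have [u u4 zu] := meet _ _ _ w3v w4v w34 z3.
  case: (X4 _ tt' tt'' t't'' u4) => e; rewrite e in zu => //.
    by case: (tri _ _ _ _ w1v x1 xz xt zu).
  by case: (sq _ _ _ _ x t'' y z w1v w4v w2v w3v w14 w23 _ _ _ _ xy xz (sym _ _ yt'') (sym _ _ zu)).
have zy'' : adj z y''.
  have [u u2 zu] := meet _ _ _ w3v w2v w32 z3.
  case: (X2 _ yy' yy'' y'y'' u2) => e; rewrite e in zu => //.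
    by case: (tri _ _ _ _ w1v x1 xz xy zu).
  by case: (sq _ _ _ _ x' z y' t' w1v w3v w2v w4v w13 w24 _ _ _ _ x'y' x't' zu zt').
(* No candidate is left for [y']: [z] already meets [y''], [z'] already meets [y], and [z''] closes
   a triangle with [t]. *)
have [u u3 y'u] := meet _ _ _ w2v w3v w23 y'2.
case: (X3 _ zz' zz'' z'z'' u3) => e; rewrite e in y'u.
- exact: y'y'' (un _ _ _ _ _ w3v w2v z3 y'2 y''2 (sym _ _ y'u) zy'').
- exact: yy' (un _ _ _ _ _ w3v w2v z'3 y2 y'2 (sym _ _ yz') (sym _ _ y'u)).
exact: tri _ _ _ _ w4v t4 ty' tz'' y'u.
Qed.
End Root.

End Component.

(** * Coloring whole components and combining them *)

Lemma conflict_connect e f : conflict e f -> connect adj (ends1 e) (ends1 f).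
Proof.
have end_connect h a : h \in Es a -> connect adj (ends1 h) a.
  have h1 : h \in Es (ends1 h) by rewrite inE /incident eqxx.
  case/(edge_ends h1)/orP=> /eqP->; first exact: connect0.
  by apply: connect1; apply: imset_f.
case/andP=> _ /existsP[a /existsP[b /and3P[/end_connect ea /end_connect fb ab]]].
apply: connect_trans ea _; apply: (@connect_trans _ _ b); last first.
  by rewrite (sym_connect_sym adj_sym).
by case/orP: ab => [/eqP->|/connect1].
Qed.

Lemma component_good v0 : ~ (forall v, connect adj v0 v -> ~ good v).
Proof.
move=> bad; pose C := [set v | connect adj v0 v].
have C_adj x y : x \in C -> adj x y -> y \in C.
  by rewrite !inE => v0x /connect1; apply: connect_trans.
have C_bad x : x \in C -> ~ good x by rewrite inE; apply: bad.
have v0C : v0 \in C by rewrite inE connect0.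
have [/existsP[v /existsP[z0 /and3P[vC z0v z02]]]|none] :=
    boolP [exists v, exists z, [&& v \in C, z != v & 1 < #|nbrs z :&: nbrs v|]]; last first.
  apply: (C_bad _ v0C); apply: (@good_square_free C) => // x y xC xy.
  rewrite leqNgt; apply: contra none => m2.
  by apply/existsP; exists x; apply/existsP; exists y; rewrite xC eq_sym xy setIC.
apply: (C_bad v vC).
(* The maximality of the number of common neighbors is what [good_common23] requires. *)
have [z zv zmax] := @arg_maxnP _ z0 (fun x => x != v) (fun x => #|nbrs x :&: nbrs v|) z0v.
have z2 : 1 < #|nbrs z :&: nbrs v| by apply: leq_trans z02 (zmax _ z0v).
have z4 : #|nbrs z :&: nbrs v| <= 4.
  by apply: leq_trans (nbrs_le v); rewrite subset_leq_card // subsetIr.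
have [/eqP m4|m4] := boolP (#|nbrs z :&: nbrs v| == 4).
  exact (good_common4 C_bad vC zv m4).
(* If no [beyond] set has size at most 7, every neighbor has two private vertices. A common neighbor
   [w] of [z] and [v] still has at most 2 + 6 edges beyond it. *)
have [/exists_inP[w wv b7]|b8] := boolP [exists w in nbrs v, #|beyond v w| <= 7].
  apply: (@good_common23 C _ _ v z w) => //.
  by rewrite z2 ltn_neqAle m4.
have [w [_ [/setIP[zw wv] _ _]]] := card_gt1P z2.
apply: (@good_two_pairs C _ _ v w) => //.
  move=> w' w'v; apply: (@card_private C) => //; rewrite ltnNge.
  by apply: contra b8 => b7; apply/exists_inP; exists w'.
apply: (@beyond_drop v w z 2) => //; first by rewrite in_setD1 zv -/(adj w z) adj_sym.
apply: leq_trans (beyond_term v z) _; lia.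
Qed.

Lemma component_color v : exists c, valid [set e | connect adj v (ends1 e)] c.
Proof.
(* Finite functions make the existence of a coloring decidable, so the negative statement
   [component_good] can be used by contradiction. *)
set D := [set e | _]; pose ok (c : {ffun E -> 'I_22}) :=
  [forall e in D, forall f in D, conflict e f ==> (c e != c f)].
have [/existsP[c okc]|none] := boolP [exists c, ok c].
  exists c => e f eD fD ef; move/forall_inP/(_ _ eD)/forall_inP/(_ _ fD): okc.
  by move/implyP; apply.
case: (@component_good v) => u vu /good_color[c vc]; case/existsP: none.
exists [ffun e => c e]; apply/forall_inP=> e; rewrite inE => ve.
apply/forall_inP=> f; rewrite inE => vf; apply/implyP; rewrite !ffunE; apply: vc;
  by rewrite inE -(same_connect (sym_connect_sym adj_sym) vu).
Qed.

End Multigraph.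

Theorem theorem1 (V E : finType) (ends1 ends2 : E -> V) :
  (forall v : V, deg ends1 ends2 v <= 4) ->
  (exists v : V, deg ends1 ends2 v = 4) ->
  exists c : E -> 'I_22, strong_edge_coloring ends1 ends2 c.
Proof.
move=> deg4 _; have [col colP] := fin_all_exists (component_color deg4).
set a := adj ends1 ends2 in colP *.
have a_sym : connect_sym a by apply: sym_connect_sym; apply: adj_sym.
(* Each edge takes its color from the coloring picked for the root of its component; conflicting
   edges share that root. *)
exists (fun e => col (root a (ends1 e)) e) => e f nef /(conflict_strong nef) ef.
have := conflict_connect ef; rewrite -/a => con.
rewrite -(rootP a_sym con); apply: (colP (root a (ends1 e)) e f _ _ ef);
  rewrite inE a_sym ?connect_root //.
by apply: connect_trans (connect_root _ _); rewrite a_sym.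
Qed.
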